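(* Let $K$ and $M$ be $n\times n$ real symmetric positive definite matrices, let $\mathcal P\subset\mathbb R^n$ be a subspace of dimension $m<n$, and let $P\in\mathbb R^{n\times m}$ be a matrix whose columns form a basis of $\mathcal P$. Let $\lambda_{\pm i}$ denote the eigenvalues of $Kx=\lambda Mx$, and let $\Lambda_{\pm i}$, $\tilde\Lambda_{\pm i}$ and $\tilde{\tilde\Lambda}_{\pm i}$ denote respectively the Ritz, harmonic Ritz and dual harmonic Ritz values associated with $\mathcal P$. Then $$\lambda_k\le \tilde{\tilde\Lambda}_k\le\Lambda_k\le\tilde\Lambda_k\qquad\text{for } k=1,2,\dots,m,$$ $$\tilde{\tilde\Lambda}_{-\ell}\le\Lambda_{-\ell}\le\tilde\Lambda_{-\ell}\le\lambda_{-\ell}\qquad\text{for }\ell=1,2,\dots,m.$$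
   Context: Labeling convention: the real eigenvalues of an eigenvalue problem, counted with multiplicity, are labeled from the edges toward the center, $\mu_1\le\mu_2\le\mu_3\le\dots\le\mu_{-3}\le\mu_{-2}\le\mu_{-1}$; that is, $\mu_k$ is the $k$-th smallest and $\mu_{-\ell}$ is the $\ell$-th largest eigenvalue. The Ritz values $\Lambda_{\pm i}$ are the $m$ eigenvalues of $P^tKPy=\Lambda\,P^tMPy$. The harmonic Ritz values $\tilde\Lambda_{\pm i}$ are the $m$ eigenvalues of $P^tKM^{-1}KPy=\tilde\Lambda\,P^tKPy$. The dual harmonic Ritz values $\tilde{\tilde\Lambda}_{\pm i}$ are the $m$ eigenvalues of $P^tMPy=\tilde{\tilde\Lambda}\,P^tMK^{-1}MPy$. *)

(* Defs.v *)
From mathcomp Require Import all_boot all_order all_algebra.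
From mathcomp Require Import polyrcf reals.

Set Implicit Arguments.
Unset Strict Implicit.
Unset Printing Implicit Defensive.

Import Order.TTheory GRing.Theory Num.Theory.
Local Open Scope ring_scope.

Definition sym_posdef (R : numFieldType) (n : nat) (A : 'M[R]_n) : Prop :=
  A \is symmetricmx /\
  forall x : 'cV[R]_n, x != 0 -> 0 < (x^T *m A *m x) 0 0.

(* For B = 1%:M this is char_poly A. *)
Definition pencil_poly (R : comNzRingType) (n : nat) (A B : 'M[R]_n) :
    {poly R} :=
  \det ('X *: map_mx polyC B - map_mx polyC A).

(* The real eigenvalues of A x = mu B x in increasing order, each repeated
   according to its multiplicity as a root of det (mu B - A); rootsR lists the
   distinct real roots in increasing order.  The list has n entries when A is
   symmetric and B is symmetric positive definite. *)
Definition gen_eigenvalues (R : rcfType) (n : nat) (A B : 'M[R]_n) : seq R :=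
  flatten [seq nseq (mup a (pencil_poly A B)) a
          | a <- rootsR (pencil_poly A B)].

(* Indices start at 1: eig_lo A B k is mu_k, the k-th smallest eigenvalue, and
   eig_hi A B l is mu_{-l}, the l-th largest one.  Both take the junk value 0
   at indices outside 1, ..., size (gen_eigenvalues A B), except that index 0
   behaves like index 1. *)
Definition eig_lo (R : rcfType) (n : nat) (A B : 'M[R]_n) (k : nat) : R :=
  nth 0 (gen_eigenvalues A B) k.-1.

Definition eig_hi (R : rcfType) (n : nat) (A B : 'M[R]_n) (l : nat) : R :=
  nth 0 (rev (gen_eigenvalues A B)) l.-1.

Section Ritz.
Variables (R : rcfType) (n m : nat) (K M : 'M[R]_n) (P : 'M[R]_(n, m)).

Definition ritz_lo := eig_lo (P^T *m K *m P) (P^T *m M *m P).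
Definition ritz_hi := eig_hi (P^T *m K *m P) (P^T *m M *m P).

Definition harmonic_ritz_lo :=
  eig_lo (P^T *m K *m invmx M *m K *m P) (P^T *m K *m P).
Definition harmonic_ritz_hi :=
  eig_hi (P^T *m K *m invmx M *m K *m P) (P^T *m K *m P).

Definition dual_harmonic_ritz_lo :=
  eig_lo (P^T *m M *m P) (P^T *m M *m invmx K *m M *m P).
Definition dual_harmonic_ritz_hi :=
  eig_hi (P^T *m M *m P) (P^T *m M *m invmx K *m M *m P).

End Ritz.

Lemma horner_pencil_poly (R : comNzRingType) (n : nat) (A B : 'M[R]_n) (a : R) :
  (pencil_poly A B).[a] = \det (a *: B - A).
Proof.
rewrite /pencil_poly -horner_evalE -det_map_mx; congr (\det _).
apply/matrixP => i j; rewrite !mxE /= horner_evalE hornerD hornerN hornerM.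
by rewrite hornerX !hornerC.
Qed.

Lemma sorted_gen_eigenvalues (R : rcfType) (n : nat) (A B : 'M[R]_n) :
  sorted <=%R (gen_eigenvalues A B).
Proof.
rewrite /gen_eigenvalues; set p := pencil_poly A B.
have: sorted <%R (rootsR p) by rewrite /rootsR sorted_roots.
elim: (rootsR p) => //= a s IHs asort.
rewrite (sorted_pairwise le_trans) pairwise_cat -!(sorted_pairwise le_trans).
apply/and3P; split; last exact/IHs/(path_sorted asort).
- apply/allrelP => x y /nseqP[-> _] /flattenP[_ /mapP[b bs ->]] /nseqP[-> _].
  by move: asort; rewrite (path_sortedE lt_trans) => /andP[/allP/(_ _ bs)/ltW].
- by elim: (mup _ _) => // -[|k] //= ->; rewrite lexx.
Qed.

Lemma mem_gen_eigenvalues (R : rcfType) (n : nat) (A B : 'M[R]_n) (a : R) :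
  pencil_poly A B != 0 ->
  a \in gen_eigenvalues A B <->
  exists2 x : 'cV[R]_n, x != 0 & A *m x = a *: (B *m x).
Proof.
move=> p0; set p := pencil_poly A B in p0.
have -> : (a \in gen_eigenvalues A B) = root p a.
  rewrite /gen_eigenvalues -/p.
  have inR b : (b \in rootsR p) = root p b.
    by have /(_ b) := roots_on_rootsR p0; rewrite inE /= => <-.
  apply/flattenP/idP => [[_ /mapP[b bs ->]] /nseqP[-> _]|ra].
    by rewrite -inR.
  exists (nseq (mup a p) a); first by apply/mapP; exists a; rewrite ?inR.
  by rewrite mem_nseq eqxx andbT mup_geq // expr1 dvdp_XsubCl.
rewrite /root horner_pencil_poly -det_tr; split=> [/det0P[v v0 vE]|[x x0 xE]].
  exists v^T; first by rewrite trmx_eq0.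
  apply/eqP; rewrite eq_sym -subr_eq0 scalemxAl -mulmxBl -trmx_eq0.
  by rewrite trmx_mul trmxK vE.
apply/det0P; exists x^T; first by rewrite trmx_eq0.
by rewrite -trmx_mul mulmxBl -scalemxAl xE subrr trmx0.
Qed.

(* Main.v *)
Require Import Defs.
From mathcomp Require Import all_boot all_order all_fingroup all_algebra.
From mathcomp Require Import complex polyrcf reals ring lra.

Set Implicit Arguments.
Unset Strict Implicit.
Unset Printing Implicit Defensive.

Import Order.TTheory GRing.Theory Num.Theory.
Local Open Scope ring_scope.

(** The three families of Ritz values are the eigenvalues of symmetric-definite
pencils, and the theorem compares their Rayleigh quotients.  Write k(x), m(x)
for the quadratic forms of K, M and h(x), d(x) for those of K M^-1 K and
M K^-1 M.  On the trial space the quotients of the dual harmonic, ordinary and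
harmonic problems are m/d, k/m and h/k.  The Cauchy-Schwarz inequality
[qform_cauchy] gives k^2 <= h m and m^2 <= d k, that is,
  m/d <= k/m <= h/k    pointwise,
and by the Courant-Fischer principle a pointwise inequality of Rayleigh
quotients passes to the i-th smallest and to the i-th largest eigenvalues
([eig_le_pointwise]).

For the two outer inequalities the trial space is moved.  If y = K^-1 M x, then
d(x) = k(y) and m(x) = h(y), so the dual harmonic quotient at x is h/k at y,
which dominates k/m at y by the same Cauchy-Schwarz inequality; hence the dual
harmonic problem dominates the compression of (K, M) to K^-1 M P, whose lower
eigenvalues lie above those of (K, M).  For the harmonic problem and the upper
eigenvalues, M^-1 K P is used instead.  The comparison lemmas
[eig_lo_compression] and [eig_hi_compression] therefore allow an injective
linear change of variables Q into a larger space.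

The eigenvalues are listed as roots of det (X B - A), so the Courant-Fischer
principle first needs the spectral theorem for pencils: a basis that is
orthonormal for B and in which A is diagonal with the listed eigenvalues as
entries ([pencil_diag], [gen_eigenvalues_spectral]). *)

(** * Quadratic forms and positive definite matrices *)

Lemma symmetricmxP (R : fieldType) (n : nat) (A : 'M[R]_n) :
  reflect (A^T = A) (A \is symmetricmx).
Proof.
rewrite is_hermitianmxE expr0 scale1r map_mx_id //.
by apply: (iffP eqP) => [<-|->]; rewrite ?trmxK.
Qed.

Definition qform (R : pzSemiRingType) (n : nat) (A : 'M[R]_n)
    (x : 'cV[R]_n) : R :=
  (x^T *m A *m x) 0 0.

Lemma qformN (R : pzRingType) (n : nat) (A : 'M[R]_n) x :
  qform (- A) x = - qform A x.
Proof. by rewrite /qform mulmxN mulNmx mxE. Qed.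

Lemma qform_congr (R : comPzRingType) (n m : nat) (A : 'M[R]_n)
    (X : 'M[R]_(n, m)) x :
  qform (X^T *m A *m X) x = qform A (X *m x).
Proof. by rewrite /qform trmx_mul !mulmxA. Qed.

Lemma qform0 (R : pzSemiRingType) (n : nat) (A : 'M[R]_n) : qform A 0 = 0.
Proof. by rewrite /qform mulmx0 mxE. Qed.

Lemma qformZ (R : comPzRingType) (n : nat) (A : 'M[R]_n) c x :
  qform A (c *: x) = c ^+ 2 * qform A x.
Proof.
rewrite /qform [(c *: x)^T]linearZ /=.
by rewrite -scalemxAr -!scalemxAl scalerA mxE expr2.
Qed.

Lemma qform_diag (R : comPzRingType) (n : nat) (d : 'rV[R]_n) x :
  qform (diag_mx d) x = \sum_i d 0 i * x i 0 ^+ 2.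
Proof.
rewrite /qform mxE; apply: eq_bigr => i _.
by rewrite mul_mx_diag !mxE expr2 mulrAC mulrC.
Qed.

Lemma qform_ge0 (R : numFieldType) (n : nat) (B : 'M[R]_n) x :
  sym_posdef B -> 0 <= qform B x.
Proof.
by case=> _ Bpos; have [->|/Bpos/ltW//] := eqVneq x 0; rewrite qform0.
Qed.

Lemma sym_congr (R : comPzRingType) (n m : nat) (A : 'M[R]_n)
    (X : 'M[R]_(n, m)) :
  A^T = A -> (X^T *m A *m X)^T = X^T *m A *m X.
Proof. by move=> As; rewrite !trmx_mul trmxK As mulmxA. Qed.

Lemma posdef_congr (R : numFieldType) (n m : nat) (B : 'M[R]_n)
    (X : 'M[R]_(n, m)) :
  sym_posdef B -> (forall x : 'cV_m, X *m x = 0 -> x = 0) ->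
  sym_posdef (X^T *m B *m X).
Proof.
case=> /symmetricmxP Bs Bpos Xinj; split; first exact/symmetricmxP/sym_congr.
move=> x x0; rewrite -/(qform _ x) qform_congr; apply: Bpos.
by apply: contra_neq x0; apply: Xinj.
Qed.

Lemma posdef_unit (R : numFieldType) (n : nat) (B : 'M[R]_n) :
  sym_posdef B -> B \in unitmx.
Proof.
case=> /symmetricmxP Bs Bpos; rewrite -row_free_unit; apply: inj_row_free => v vB.
apply/eqP; apply/negPn/negP => v0.
have /Bpos : v^T != 0 by rewrite trmx_eq0.
by rewrite trmxK vB mul0mx mxE ltxx.
Qed.

Lemma sym_invmx (R : fieldType) (n : nat) (B : 'M[R]_n) :
  B^T = B -> (invmx B)^T = invmx B.
Proof. by rewrite trmx_inv => ->. Qed.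

Lemma posdef_invmx (R : numFieldType) (n : nat) (B : 'M[R]_n) :
  sym_posdef B -> sym_posdef (invmx B).
Proof.
move=> Bspd; have uB := posdef_unit Bspd; have [/symmetricmxP Bs _] := Bspd.
rewrite -[invmx B]mul1mx -{1}(mulVmx uB) -{1}(sym_invmx Bs).
apply: posdef_congr => // x; move/(congr1 (mulmx B)).
by rewrite mulKVmx // mulmx0.
Qed.

(** * Spectral theorem for symmetric-definite pencils *)

Lemma map_Re_mulmx (R : rcfType) (m n p : nat) (v : 'M[R[i]]_(m, n))
    (A : 'M[R]_(n, p)) :
  map_mx (@complex.Re R) (v *m map_mx (real_complex R) A) =
  map_mx (@complex.Re R) v *m A.
Proof.
apply/matrixP => i j; rewrite !mxE (raddf_sum (@complex.Re R)).
apply: eq_bigr => k _; rewrite !mxE; case: (v i k) => a b /=.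
by rewrite mulr0 subr0.
Qed.

Lemma map_Im_mulmx (R : rcfType) (m n p : nat) (v : 'M[R[i]]_(m, n))
    (A : 'M[R]_(n, p)) :
  map_mx (@complex.Im R) (v *m map_mx (real_complex R) A) =
  map_mx (@complex.Im R) v *m A.
Proof.
apply/matrixP => i j; rewrite !mxE (raddf_sum (@complex.Im R)).
apply: eq_bigr => k _; rewrite !mxE; case: (v i k) => a b /=.
by rewrite mulr0 add0r.
Qed.

(** Over R[i] there is an eigenvector x + i y, with eigenvalue a + i b.
Evaluating the bilinear form of A at (x, y) in both orders and using symmetry
gives b (x^T B x + y^T B y) = 0, so that b = 0 by definiteness; x and y then
both satisfy A z = a B z, and one of them is nonzero. *)
Lemma eigenpair_exists (R : rcfType) (n : nat) (A B : 'M[R]_n.+1) :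
  A^T = A -> sym_posdef B ->
  exists (a : R) (x : 'cV[R]_n.+1), qform B x = 1 /\ A *m x = a *: (B *m x).
Proof.
move=> As Bspd; have uB := posdef_unit Bspd; have [/symmetricmxP Bs Bpos] := Bspd.
(* A left eigenvector v of A B^-1 for c satisfies v A = c v B. *)
have [c /eigenvalueP[v vE v0]] :=
  eigenvalue_closed (map_mx (real_complex R) (A *m invmx B)) (ltn0Sn n).
have vAB :
    v *m map_mx (real_complex R) A = c *: (v *m map_mx (real_complex R) B).
  by rewrite scalemxAl -vE -mulmxA -map_mxM mulmxKV.
case: c {vE} vAB => a b vAB.
pose x := (map_mx (@complex.Re R) v)^T; pose y := (map_mx (@complex.Im R) v)^T.
have xE : A *m x = a *: (B *m x) - b *: (B *m y).
  apply: trmx_inj; rewrite trmx_mul linearB !linearZ /= !trmx_mul !trmxK As Bs.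
  rewrite -map_Re_mulmx vAB -map_Re_mulmx -map_Im_mulmx.
  move: (v *m map_mx _ B) => w; apply/matrixP => i j; rewrite !mxE.
  by case: (w i j) => p q; rewrite /= mulrN.
have yE : A *m y = a *: (B *m y) + b *: (B *m x).
  apply: trmx_inj; rewrite trmx_mul linearD !linearZ /= !trmx_mul !trmxK As Bs.
  rewrite -map_Im_mulmx vAB -map_Re_mulmx -map_Im_mulmx.
  move: (v *m map_mx _ B) => w; apply/matrixP => i j; rewrite !mxE.
  by case: (w i j).
have xy0 : (x != 0) || (y != 0).
  apply: contra_neqT v0; rewrite negb_or !negbK => /andP[/eqP x0 /eqP y0].
  apply/matrixP => i j; apply/eqP; rewrite eq_complex !mxE /=.
  move/matrixP/(_ j i): x0; rewrite !mxE => ->.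
  by move/matrixP/(_ j i): y0; rewrite !mxE => ->; rewrite eqxx.
clearbody x y.
have b0 : b = 0.
  have sw (C : 'M[R]_n.+1) : C^T = C ->
      (x^T *m (C *m y)) 0 0 = (y^T *m (C *m x)) 0 0.
    move=> Cs; have -> : y^T *m (C *m x) = (x^T *m (C *m y))^T.
      by rewrite !trmx_mul trmxK Cs mulmxA.
    by rewrite [RHS]mxE.
  have qE (z : 'cV[R]_n.+1) : (z^T *m (B *m z)) 0 0 = qform B z.
    by rewrite /qform mulmxA.
  have := sw A As; rewrite xE yE mulmxDr mulmxBr -!scalemxAr.
  have combE (c d : R) (U V : 'M[R]_1) :
      (c *: U + d *: V) 0 0 = c * U 0 0 + d * V 0 0.
    by rewrite !mxE.
  rewrite -scaleNr !combE !qE (sw B Bs) => eqAB.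
  have /eqP : b * (qform B x + qform B y) = 0 by lra.
  rewrite mulf_eq0 paddr_eq0 ?qform_ge0 //.
  case/orP => [/eqP//|/andP[/eqP qx0 /eqP qy0]].
  by case/orP: xy0 => /Bpos; rewrite -/(qform B _) ?qx0 ?qy0 ltxx.
have {xy0} [z z0 zE] : exists2 z : 'cV[R]_n.+1, z != 0 & A *m z = a *: (B *m z).
  case/orP: xy0 => ?; [exists x|exists y] => //.
    by rewrite xE b0 scale0r subr0.
  by rewrite yE b0 scale0r addr0.
have qz : 0 < qform B z by apply: Bpos.
exists a, ((Num.sqrt (qform B z))^-1 *: z); split; last first.
  by rewrite -!scalemxAr zE !scalerA mulrC.
by rewrite qformZ exprVn sqr_sqrtr ?ltW // mulVf // gt_eqF.
Qed.

Lemma hyperplane_basis (R : fieldType) (n : nat) (g : 'cV[R]_n.+1) :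
  g != 0 -> exists2 W : 'M[R]_(n.+1, n),
    forall z : 'cV_n, W *m z = 0 -> z = 0 & W^T *m g = 0.
Proof.
(* The columns of W come from a row basis of the kernel, whose height is a rank
   that has to be replaced by n before it can be named. *)
move=> g0; have : \rank (kermx g) = n.
  by rewrite mxrank_ker -mxrank_tr rank_rV trmx_eq0 g0 subn1.
have : row_base (kermx g) *m g = 0 by apply/sub_kermxP; rewrite eq_row_base.
move: (row_base _) (row_base_free (kermx g)) => V Vfree Vg rk.
move: V Vfree Vg; rewrite rk => V Vfree Vg; exists V^T; rewrite ?trmxK // => z.
move=> /(congr1 trmx); rewrite trmx_mul trmxK trmx0 => zV.
by apply/trmx_inj/(row_free_inj Vfree); rewrite /= zV trmx0 mul0mx.
Qed.

(** Deflation: after splitting off a B-normalized eigenvector x, the matrix A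
preserves the decomposition into x and its B-orthogonal complement, since
w^T A x = a w^T B x = 0 there; induction applies to the pencil compressed to
the complement. *)
Lemma pencil_diag (R : rcfType) (n : nat) (A B : 'M[R]_n) :
  A^T = A -> sym_posdef B ->
  exists (X : 'M[R]_n) (d : 'rV[R]_n),
    X^T *m B *m X = 1%:M /\ X^T *m A *m X = diag_mx d.
Proof.
elim: n A B => [|n IH] A B As Bspd.
  by exists 0, 0; split; apply/matrixP => -[].
have [a [x [qx xE]]] := eigenpair_exists As Bspd.
have [/symmetricmxP Bs _] := Bspd.
have Bx0 : B *m x != 0.
  apply/eqP => Bx; move/eqP: qx; rewrite /qform -mulmxA Bx mulmx0 mxE.
  by rewrite eq_sym oner_eq0.
have [W Winj WBx] := hyperplane_basis Bx0.
have [Y [d [YB YA]]] := IH _ _ (sym_congr W As) (posdef_congr Bspd Winj).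
pose X : 'M_(1 + n) := row_mx x (W *m Y).
have blk (C : 'M[R]_(1 + n)) (D : 'M[R]_n) :
    C^T = C -> W^T *m (C *m x) = 0 -> Y^T *m (W^T *m C *m W) *m Y = D ->
    X^T *m C *m X = block_mx (x^T *m (C *m x)) 0 0 D.
  move=> Cs WCx <-; rewrite /X tr_row_mx mul_col_mx mul_col_row !trmx_mul.
  have xCW : x^T *m C *m W = 0.
    by apply: trmx_inj; rewrite !trmx_mul trmxK Cs trmx0 WCx.
  congr (block_mx _ _ _ _); rewrite ?mulmxA ?xCW ?mul0mx //.
  by rewrite -!mulmxA WCx mulmx0.
have xBx : x^T *m (B *m x) = 1%:M.
  by apply/matrixP => i j; rewrite !ord1 mulmxA [LHS]qx mxE.
exists X, (row_mx a%:M d : 'rV_(1 + n)); split.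
  by rewrite (blk _ _ Bs WBx YB) xBx -scalar_mx_block.
rewrite (blk _ _ As _ YA) xE -?scalemxAr ?WBx ?scaler0 // xBx.
have -> : a *: 1%:M = diag_mx a%:M :> 'M_1.
  by apply/matrixP => i j; rewrite !ord1 !mxE mulr1.
exact: (esym (diag_mx_row a%:M d)).
Qed.

Lemma pencil_poly_diag (R : comNzRingType) (n : nat) (A B X : 'M[R]_n) d :
  X^T *m B *m X = 1%:M -> X^T *m A *m X = diag_mx d ->
  (\det X ^+ 2)%:P * pencil_poly A B = \prod_i ('X - (d 0 i)%:P).
Proof.
move=> XB XA; pose X' := map_mx polyC X.
have mapXCX C : map_mx polyC (X^T *m C *m X) = X'^T *m map_mx polyC C *m X'.
  by rewrite !map_mxM map_trmx.
have -> : (\det X ^+ 2)%:P * pencil_poly A B =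
    \det ('X *: map_mx polyC (X^T *m B *m X) - map_mx polyC (X^T *m A *m X)).
  rewrite !mapXCX scalemxAl scalemxAr -mulmxBl -mulmxBr !det_mulmx det_tr.
  by rewrite det_map_mx polyCM mulrAC.
rewrite XB XA map_diag_mx map_scalar_mx scale_scalar_mx mulr1.
rewrite -diag_const_mx -raddfB det_diag; apply: eq_bigr => i _.
by rewrite !mxE.
Qed.

(** A congruence multiplies the pencil polynomial by a nonzero constant, which
changes neither the roots nor their multiplicities. *)
Lemma gen_eigenvalues_diag (R : rcfType) (n : nat) (A B X : 'M[R]_n) d :
  X^T *m B *m X = 1%:M -> X^T *m A *m X = diag_mx d ->
  perm_eq (gen_eigenvalues A B) [seq d 0 i | i <- enum 'I_n].
Proof.
move=> XB XA; set s := [seq _ | i <- _].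
have := pencil_poly_diag XB XA; set c := _ ^+ 2; set p := pencil_poly A B => pE.
have {pE} sE : c%:P * p = \prod_(a <- s) ('X - a%:P).
  by rewrite big_map big_enum.
have cp0 : c%:P * p != 0 by rewrite sE monic_neq0 // monic_prod_XsubC.
have /andP[c0 p0] : (c%:P != 0) && (p != 0) by rewrite -negb_or -mulf_eq0.
have mupE a : mup a p = count_mem a s.
  by rewrite -mu_prod_XsubC -sE mupMr // rootC -polyC_eq0.
have inR a : (a \in rootsR p) = root p a.
  by have /(_ a) := roots_on_rootsR p0; rewrite inE /= => <-.
rewrite /gen_eigenvalues -/p (eq_map (g := fun a => nseq (count_mem a s) a)); last first.
  by move=> a; rewrite mupE.
apply: perm_trans (perm_count_undup s).
apply: perm_flatten; apply: perm_map; apply: uniq_perm; rewrite ?undup_uniq //.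
  exact: uniq_roots.
move=> a; rewrite inR mem_undup -root_prod_XsubC -sE rootM rootC.
by rewrite -polyC_eq0 (negbTE c0).
Qed.

(** The columns of a diagonalizing basis are permuted so that the diagonal is
increasing: index bounds then become bounds on the eigenvalues. *)
Lemma gen_eigenvalues_spectral (R : rcfType) (n : nat) (A B : 'M[R]_n) :
  A^T = A -> sym_posdef B ->
  size (gen_eigenvalues A B) = n /\
  exists X : 'M[R]_n, X^T *m B *m X = 1%:M /\
    X^T *m A *m X = diag_mx (\row_i (gen_eigenvalues A B)`_i).
Proof.
move=> As Bspd; have [X [d [XB XA]]] := pencil_diag As Bspd.
have /tuple_permP[p sE] : perm_eq (gen_eigenvalues A B) [tuple d 0 i | i < n].
  exact: gen_eigenvalues_diag XB XA.
split; first by rewrite sE size_tuple.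
have permE C : (col_perm p X)^T *m C *m col_perm p X =
    row_perm p (col_perm p (X^T *m C *m X)).
  by rewrite tr_col_perm !row_permE !col_permE !mulmxA.
exists (col_perm p X); rewrite !permE XB XA; split; apply/matrixP => i j.
  by rewrite !mxE (inj_eq perm_inj).
by rewrite !mxE sE nth_mktuple tnth_mktuple (inj_eq perm_inj).
Qed.

(** * Courant-Fischer principle *)

(** First half of the min-max principle, attained on the span of the first k
vectors of the eigenbasis.  Subspaces are given by injective matrices. *)
Lemma subspace_eig_lo (R : rcfType) (n k : nat) (A B : 'M[R]_n) :
  A^T = A -> sym_posdef B -> (0 < k <= n)%N ->
  exists2 Y : 'M[R]_(n, k), forall z : 'cV_k, Y *m z = 0 -> z = 0 &
    forall z, qform A (Y *m z) <= eig_lo A B k * qform B (Y *m z).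
Proof.
move=> As Bspd /andP[k0 kn].
have [sz [X [XB XA]]] := gen_eigenvalues_spectral As Bspd.
have [_ Xu] := mulmx1_unit XB.
exists (X *m pid_mx k) => [z|z]; rewrite -mulmxA.
  move/(congr1 (mulmx (invmx X))); rewrite mulKmx // mulmx0.
  move/(congr1 (mulmx (pid_mx k : 'M_(k, n)))).
  by rewrite mulmxA pid_mx_id // pid_mx_1 mul1mx mulmx0.
rewrite -!(qform_congr _ X) XA XB -diag_const_mx !qform_diag mulr_sumr.
apply: ler_sum => i _; rewrite !mxE mul1r.
have [ik|ki] := ltnP i k.
  apply: ler_wpM2r; rewrite ?sqr_ge0 //.
  apply: (sorted_leq_nth le_trans lexx 0 (sorted_gen_eigenvalues A B)).
  - by rewrite inE sz.
  - by rewrite inE sz prednK.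
  - by rewrite -ltnS prednK.
rewrite big1 ?expr0n ?mulr0 // => j _.
by rewrite mxE ltnNge ki andbF mul0r.
Qed.

(** Second half of the min-max principle: any k-dimensional subspace contains a
nonzero vector whose first k - 1 coordinates in the eigenbasis vanish, and its
Rayleigh quotient is at least the k-th eigenvalue. *)
Lemma eig_lo_subspace (R : rcfType) (n k : nat) (A B : 'M[R]_n)
    (Y : 'M[R]_(n, k)) (t : R) :
  A^T = A -> sym_posdef B -> (0 < k <= n)%N ->
  (forall z : 'cV_k, Y *m z = 0 -> z = 0) ->
  (forall z, qform A (Y *m z) <= t * qform B (Y *m z)) ->
  eig_lo A B k <= t.
Proof.
case: k Y => // k Y As Bspd /= kn Yinj Yt; rewrite /eig_lo /=.
have [sz [X [XB XA]]] := gen_eigenvalues_spectral As Bspd.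
have [_ Xu] := mulmx1_unit XB.
(* The kernel of G consists of the z for which Y z has no component on the first
   k vectors of the eigenbasis; here k + 1 is the dimension of the subspace. *)
pose G : 'M_(k, k.+1) := pid_mx k *m (invmx X *m Y).
have [z z0 Gz] : exists2 z : 'cV_k.+1, z != 0 & G *m z = 0.
  have : kermx G^T != 0.
    rewrite -mxrank_eq0 mxrank_ker subn_eq0 -ltnNge ltnS.
    exact: rank_leq_col.
  case/rowV0Pn => v /sub_kermxP vG v0; exists v^T; rewrite ?trmx_eq0 //.
  by apply: trmx_inj; rewrite trmx_mul trmxK vG trmx0.
have [w wE] : exists w, w = invmx X *m (Y *m z) by exists (invmx X *m (Y *m z)).
have w0 : w != 0.
  apply: contra_neq z0; rewrite wE => /(congr1 (mulmx X)); rewrite mulKVmx // mulmx0.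
  exact: Yinj.
have wlow (i : 'I_n) : (i < k)%N -> w i 0 = 0.
  move=> ik; move/matrixP/(_ (Ordinal ik) 0): Gz.
  rewrite /G -!mulmxA -wE !mxE (bigD1 i) //= big1 => [|j ji].
    by rewrite !mxE eqxx ik mul1r addr0.
  by rewrite !mxE /= eq_sym (negbTE (ji : j != i :> nat)) mul0r.
have := Yt z; have -> : Y *m z = X *m w by rewrite wE mulKVmx.
rewrite -!(qform_congr _ X) XA XB -diag_const_mx !qform_diag mulr_sumr -subr_le0.
apply: contraTT; rewrite -!ltNge -sumrB => tlt.
have dge (i : 'I_n) : (k <= i)%N -> t < (gen_eigenvalues A B)`_i.
  move=> ki; apply: lt_le_trans tlt _.
  by apply: (sorted_leq_nth le_trans lexx 0 (sorted_gen_eigenvalues A B));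
    rewrite ?inE ?sz.
have term (i : 'I_n) :
    0 <= (gen_eigenvalues A B)`_i * w i 0 ^+ 2 - t * (1 * w i 0 ^+ 2).
  rewrite mul1r -mulrBl; have [/wlow ->|/dge ti] := ltnP i k.
    by rewrite expr0n mulr0.
  by rewrite mulr_ge0 ?sqr_ge0 // subr_ge0 ltW.
under eq_bigr do rewrite !mxE.
have /cV0Pn[i wi] := w0.
rewrite (bigD1 i) //=; apply: ltr_wpDr; first exact: sumr_ge0.
rewrite mul1r -mulrBl mulr_gt0 ?exprn_even_gt0 // subr_gt0 dge // leqNgt.
by apply: contra_neqN wi; apply: wlow.
Qed.

(** The hypothesis is the inequality of Rayleigh quotients
A2/B2 (Q x) <= A1/B1 (x), cross-multiplied so that x = 0 needs no exception.
An optimal subspace for the first pencil, mapped by Q, is then a trial subspace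
for the second. *)
Lemma eig_lo_compression (R : rcfType) (m n k : nat) (A1 B1 : 'M[R]_m)
    (A2 B2 : 'M[R]_n) (Q : 'M[R]_(n, m)) :
  A1^T = A1 -> sym_posdef B1 -> A2^T = A2 -> sym_posdef B2 ->
  (forall x : 'cV_m, Q *m x = 0 -> x = 0) -> (m <= n)%N -> (0 < k <= m)%N ->
  (forall x,
    qform A2 (Q *m x) * qform B1 x <= qform A1 x * qform B2 (Q *m x)) ->
  eig_lo A2 B2 k <= eig_lo A1 B1 k.
Proof.
move=> A1s B1spd A2s B2spd Qinj mn /andP[k0 km] le12.
have [Y Yinj Yt] := subspace_eig_lo A1s B1spd (introT andP (conj k0 km)).
apply: (@eig_lo_subspace _ _ _ _ _ (Q *m Y)) => // [|z|z].
- by rewrite k0 (leq_trans km).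
- by rewrite -mulmxA => /Qinj/Yinj.
rewrite -mulmxA; have [-> | x0] := eqVneq (Y *m z) 0.
  by rewrite mulmx0 !qform0 mulr0.
have B1x : 0 < qform B1 (Y *m z) by case: B1spd => _; apply.
rewrite -(ler_pM2r B1x); apply: le_trans (le12 _) _.
by rewrite mulrAC ler_wpM2r ?qform_ge0.
Qed.

Lemma gen_eigenvaluesN (R : rcfType) (n : nat) (A B : 'M[R]_n) :
  A^T = A -> sym_posdef B ->
  gen_eigenvalues (- A) B = rev [seq - a | a <- gen_eigenvalues A B].
Proof.
move=> As Bspd; have [X [d [XB XA]]] := pencil_diag As Bspd.
apply: le_sorted_eq; first exact: sorted_gen_eigenvalues.
  rewrite rev_sorted sorted_map; apply: sub_sorted (sorted_gen_eigenvalues A B).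
  by move=> a b; rewrite /= lerN2.
have XNA : X^T *m - A *m X = diag_mx (- d) by rewrite mulmxN mulNmx XA raddfN.
rewrite perm_sym perm_rev perm_sym.
apply: perm_trans (gen_eigenvalues_diag XB XNA) _; rewrite perm_sym.
apply: perm_trans (perm_map _ (gen_eigenvalues_diag XB XA)) _.
rewrite -map_comp (eq_map (g := fun i => (- d) 0 i)) // => i.
by rewrite /= mxE.
Qed.

(** Upper eigenvalues are the negated lower eigenvalues of (- A, B), so each
fact about the lower end has a mirror image. *)
Lemma eig_hiN (R : rcfType) (n l : nat) (A B : 'M[R]_n) :
  A^T = A -> sym_posdef B -> eig_hi A B l = - eig_lo (- A) B l.
Proof.
move=> As Bspd; rewrite /eig_hi /eig_lo gen_eigenvaluesN // -map_rev.
set s := rev _; have [ls|ls] := ltnP l.-1 (size s).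
  by rewrite (nth_map 0) // opprK.
by rewrite !nth_default ?oppr0 // size_map.
Qed.

Lemma eig_hi_compression (R : rcfType) (m n l : nat) (A1 B1 : 'M[R]_m)
    (A2 B2 : 'M[R]_n) (Q : 'M[R]_(n, m)) :
  A1^T = A1 -> sym_posdef B1 -> A2^T = A2 -> sym_posdef B2 ->
  (forall x : 'cV_m, Q *m x = 0 -> x = 0) -> (m <= n)%N -> (0 < l <= m)%N ->
  (forall x,
    qform A1 x * qform B2 (Q *m x) <= qform A2 (Q *m x) * qform B1 x) ->
  eig_hi A1 B1 l <= eig_hi A2 B2 l.
Proof.
move=> A1s B1spd A2s B2spd Qinj mn lm le12; rewrite !eig_hiN // lerN2.
apply: (eig_lo_compression (Q := Q)) => //; rewrite ?linearN /= ?A1s ?A2s //.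
by move=> x; rewrite !qformN !mulNr lerN2.
Qed.

Lemma eig_le_pointwise (R : rcfType) (n k : nat) (A1 B1 A2 B2 : 'M[R]_n) :
  A1^T = A1 -> sym_posdef B1 -> A2^T = A2 -> sym_posdef B2 ->
  (0 < k <= n)%N ->
  (forall x, qform A2 x * qform B1 x <= qform A1 x * qform B2 x) ->
  eig_lo A2 B2 k <= eig_lo A1 B1 k /\ eig_hi A2 B2 k <= eig_hi A1 B1 k.
Proof.
move=> A1s B1spd A2s B2spd kn le21.
by split; [apply: (eig_lo_compression (Q := 1%:M))
          |apply: (eig_hi_compression (Q := 1%:M))] => // x; rewrite mul1mx.
Qed.

(** * Comparison of the three Ritz problems *)

(** The form of T S^-1 T is that of S after the change of variables
y = S^-1 T x.  This both reduces [qform_cauchy] to the usual Cauchy-Schwarz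
inequality and relates the harmonic problems to moved trial spaces. *)
Lemma qform_sandwich (R : fieldType) (n : nat) (S T : 'M[R]_n) x :
  S \in unitmx -> S^T = S -> T^T = T ->
  qform (T *m invmx S *m T) x = qform S (invmx S *m (T *m x)).
Proof.
move=> Su Ss Ts.
by rewrite /qform !trmx_mul sym_invmx // Ts -!mulmxA mulKVmx.
Qed.

(** Cauchy-Schwarz inequality for the inner product of S, applied to x and
S^-1 T x. *)
Lemma qform_cauchy (R : numFieldType) (n : nat) (S T : 'M[R]_n) x :
  sym_posdef S -> T^T = T ->
  qform T x ^+ 2 <= qform (T *m invmx S *m T) x * qform S x.
Proof.
move=> Sspd Ts; have Su := posdef_unit Sspd; have [/symmetricmxP Ss Spos] := Sspd.
pose y := invmx S *m (T *m x).
have Sy : S *m y = T *m x by rewrite mulKVmx.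
have -> : qform (T *m invmx S *m T) x = qform S y.
  exact: qform_sandwich.
have bE : qform T x = (x^T *m (S *m y)) 0 0 by rewrite Sy /qform mulmxA.
have bE' : qform T x = (y^T *m (S *m x)) 0 0.
  rewrite bE; have -> : y^T *m (S *m x) = (x^T *m (S *m y))^T.
    by rewrite !trmx_mul trmxK Ss mulmxA.
  by rewrite [RHS]mxE.
clearbody y; have [y0|y0] := eqVneq y 0.
  by rewrite bE y0 !mulmx0 mxE expr0n qform0 mul0r.
have Sy_gt0 : 0 < qform S y by apply: Spos.
set p := qform S x; set r := qform S y in Sy_gt0 *; set b := qform T x.
(* r x - b y is r times the component of x that is S-orthogonal to y. *)
have : 0 <= qform S (r *: x - b *: y) by apply: qform_ge0.
have -> : qform S (r *: x - b *: y) = r * (r * p - b ^+ 2).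
  have entB (U V : 'M[R]_1) : (U - V) 0 0 = U 0 0 - V 0 0 by rewrite !mxE.
  have entZ c (U : 'M[R]_1) : (c *: U) 0 0 = c * U 0 0 by rewrite !mxE.
  have trE : (r *: x - b *: y)^T = r *: x^T - b *: y^T.
    by apply/rowP => i; rewrite !mxE.
  rewrite /qform trE -mulmxA mulmxBr -!scalemxAr mulmxBl !mulmxBr -!scalemxAl.
  rewrite -!scalemxAr !(entB, entZ) -bE -bE' -/b.
  rewrite !mulmxA -!/(qform S _) -/p -/r; ring.
by rewrite pmulr_rge0 // subr_ge0.
Qed.

Lemma basis_of_cols_inj (R : fieldType) (n m : nat) (U : {vspace 'cV[R]_n})
    (P : 'M[R]_(n, m)) :
  basis_of U [seq col j P | j : 'I_m] -> forall x : 'cV_m, P *m x = 0 -> x = 0.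
Proof.
move=> /basis_free Pfree x Px0.
have /freeP xP : free [tuple col j P | j < m] by [].
apply/colP => j; rewrite mxE; apply: (xP (fun j => x j 0)) => //.
rewrite -[RHS]Px0; apply/colP => i; rewrite summxE mxE; apply: eq_bigr => h _.
by rewrite -tnth_nth tnth_mktuple !mxE mulrC.
Qed.

Theorem theorem1p1 (R : realType) (n m : nat) (K M : 'M[R]_n)
    (hK : sym_posdef K) (hM : sym_posdef M)
    (calP : {vspace 'cV[R]_n}) (hdim : \dim calP = m) (hmn : (m < n)%N)
    (P : 'M[R]_(n, m))
    (hP : basis_of calP [seq col j P | j : 'I_m]) :
  (forall k : nat, (1 <= k <= m)%N ->
     [/\ eig_lo K M k <= dual_harmonic_ritz_lo K M P k,
         dual_harmonic_ritz_lo K M P k <= ritz_lo K M P k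
       & ritz_lo K M P k <= harmonic_ritz_lo K M P k]) /\
  (forall l : nat, (1 <= l <= m)%N ->
     [/\ dual_harmonic_ritz_hi K M P l <= ritz_hi K M P l,
         ritz_hi K M P l <= harmonic_ritz_hi K M P l
       & harmonic_ritz_hi K M P l <= eig_hi K M l]).
Proof.
have Pinj := basis_of_cols_inj hP.
have mn := ltnW hmn.
have [[/symmetricmxP Ks _] [/symmetricmxP Ms _]] := (hK, hM).
have [Ku Mu] := (posdef_unit hK, posdef_unit hM).
pose KMK := K *m invmx M *m K; pose MKM := M *m invmx K *m M.
have KMKspd : sym_posdef KMK.
  rewrite /KMK -{1}Ks; apply: posdef_congr (posdef_invmx hM) _ => x.
  by move/(congr1 (mulmx (invmx K))); rewrite mulKmx // mulmx0.
have MKMspd : sym_posdef MKM.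
  rewrite /MKM -{1}Ms; apply: posdef_congr (posdef_invmx hK) _ => x.
  by move/(congr1 (mulmx (invmx M))); rewrite mulKmx // mulmx0.
have [[/symmetricmxP KMKs _] [/symmetricmxP MKMs _]] := (KMKspd, MKMspd).
have csK x : qform K x * qform K x <= qform KMK x * qform M x.
  by rewrite -expr2; apply: qform_cauchy.
have csM x : qform M x * qform M x <= qform K x * qform MKM x.
  by rewrite -expr2 [leRHS]mulrC; apply: qform_cauchy.
have KMKE : P^T *m K *m invmx M *m K *m P = P^T *m KMK *m P.
  by rewrite /KMK !mulmxA.
have MKME : P^T *m M *m invmx K *m M *m P = P^T *m MKM *m P.
  by rewrite /MKM !mulmxA.
have symP C : C^T = C -> (P^T *m C *m P)^T = P^T *m C *m P by exact: sym_congr.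
have spdP C : sym_posdef C -> sym_posdef (P^T *m C *m P).
  by move=> Cspd; apply: posdef_congr.
have dual_ritz k : (1 <= k <= m)%N ->
    dual_harmonic_ritz_lo K M P k <= ritz_lo K M P k /\
    dual_harmonic_ritz_hi K M P k <= ritz_hi K M P k.
  move=> km; rewrite /dual_harmonic_ritz_lo /dual_harmonic_ritz_hi MKME.
  apply: eig_le_pointwise; rewrite ?symP //; try exact: spdP.
  by move=> x; rewrite !qform_congr.
have ritz_harmonic k : (1 <= k <= m)%N ->
    ritz_lo K M P k <= harmonic_ritz_lo K M P k /\
    ritz_hi K M P k <= harmonic_ritz_hi K M P k.
  move=> km; rewrite /harmonic_ritz_lo /harmonic_ritz_hi KMKE.
  apply: eig_le_pointwise; rewrite ?symP //; try exact: spdP.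
  by move=> x; rewrite !qform_congr.
split=> k km; have [dr_lo dr_hi] := dual_ritz k km;
  have [rh_lo rh_hi] := ritz_harmonic k km; split=> //.
  rewrite /dual_harmonic_ritz_lo MKME.
  apply: (eig_lo_compression (Q := invmx K *m M *m P)) => //;
    rewrite ?symP //; try exact: spdP.
    move=> x /(congr1 (mulmx K)); rewrite -!mulmxA mulKVmx // mulmx0.
    by move/(congr1 (mulmx (invmx M))); rewrite mulKmx // mulmx0 => /Pinj.
  move=> x; rewrite !qform_congr; set y := _ *m x.
  have yE : y = invmx K *m (M *m (P *m x)) by rewrite /y !mulmxA.
  have Px : P *m x = invmx M *m (K *m y) by rewrite yE mulKVmx // mulKmx.
  have -> : qform MKM (P *m x) = qform K y by rewrite qform_sandwich // -yE.
  have -> : qform M (P *m x) = qform KMK y by rewrite qform_sandwich // -Px.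
  exact: csK.
rewrite /harmonic_ritz_hi KMKE.
apply: (eig_hi_compression (Q := invmx M *m K *m P)) => //;
  rewrite ?symP //; try exact: spdP.
  move=> x /(congr1 (mulmx M)); rewrite -!mulmxA mulKVmx // mulmx0.
  by move/(congr1 (mulmx (invmx K))); rewrite mulKmx // mulmx0 => /Pinj.
move=> x; rewrite !qform_congr; set y := _ *m x.
have yE : y = invmx M *m (K *m (P *m x)) by rewrite /y !mulmxA.
have Px : P *m x = invmx K *m (M *m y) by rewrite yE mulKVmx // mulKmx.
have -> : qform KMK (P *m x) = qform M y by rewrite qform_sandwich // -yE.
have -> : qform K (P *m x) = qform MKM y by rewrite qform_sandwich // -Px.
exact: csM.
Qed.
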